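(* Let $\Gamma$ be a distance-regular graph with classical parameters $(D,b,\alpha,\beta)$ such that $b\ge 2$ and $D\ge 3$. Let $r=[D]$. If $$\beta \geq \max\left\{\tfrac{2b+4}{2b+3}\,r\,(b+2)(\alpha b+b+\alpha),\ \tfrac{2b+4}{2b+3}\,r\,\big((b+1)(b^2+b+2)-3\big)\right\},$$ then $\Gamma$ is geometric.
   Context: Distance-regular graph with intersection numbers $b_i,c_i$, valency $k=b_0$. For integer $b\ne1$, $[j]=\frac{b^j-1}{b-1}$. Classical parameters $(D,b,\alpha,\beta)$: diameter $D$, $b_i=([D]-[i])(\beta-\alpha[i])$ ($0\le i\le D-1$), $c_i=[i](1+\alpha[i-1])$ ($1\le i\le D$). A Delsarte clique is a clique with $1+\frac{k}{-\theta_{\min}}$ vertices, $\theta_{\min}$ the smallest adjacency eigenvalue; $\Gamma$ is geometric if there is a set of Delsarte cliques such that every edge lies in exactly one of them. *)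

(* Defs.v *)
From mathcomp Require Import all_boot all_order all_algebra.
Set Implicit Arguments. Unset Strict Implicit. Unset Printing Implicit Defensive.
Import Order.TTheory GRing.Theory Num.Theory.
Local Open Scope ring_scope.

Fixpoint ball (T : finType) (e : rel T) (n : nat) (x : T) : {set T} :=
  match n with
  | 0 => [set x]
  | n'.+1 => ball e n' x :|: [set z | [exists y in ball e n' x, e y z]]
  end.

Definition dist_eq (T : finType) (e : rel T) (i : nat) (x y : T) : bool :=
  (y \in ball e i x) && ((i == 0)%N || (y \notin ball e i.-1 x)).

Definition drg (T : finType) (e : rel T) (D : nat) (bn cn : nat -> nat) : Prop :=
  [/\ symmetric e /\ irreflexive e,
      (forall x y : T, y \in ball e D x),
      (exists x y : T, dist_eq e D x y),
      (forall (i : nat) (x y : T), (i < D)%N -> dist_eq e i x y ->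
          #|[set z | e y z && dist_eq e i.+1 x z]| = bn i) &
      (forall (i : nat) (x y : T), (0 < i <= D)%N -> dist_eq e i x y ->
          #|[set z | e y z && dist_eq e i.-1 x z]| = cn i)].

Definition qnum (R : fieldType) (b : int) (j : nat) : R :=
  ((b%:~R) ^+ j - 1) / (b%:~R - 1).

Definition classical_params (R : fieldType) (D : nat) (bn cn : nat -> nat)
    (b : int) (alpha beta : R) : Prop :=
  b != 1 /\
  (forall i : nat, (i <= D - 1)%N ->
      (bn i)%:R = (qnum R b D - qnum R b i) * (beta - alpha * qnum R b i)) /\
  (forall i : nat, (1 <= i <= D)%N ->
      (cn i)%:R = qnum R b i * (1 + alpha * qnum R b (i - 1))).

Definition adjmx (R : fieldType) (T : finType) (e : rel T) : 'M[R]_#|T| :=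
  \matrix_(i, j) (e (enum_val i) (enum_val j))%:R.

Definition min_eigenvalue (R : rcfType) (T : finType) (e : rel T) (theta : R) : Prop :=
  eigenvalue (adjmx R e) theta /\
  (forall mu : R, eigenvalue (adjmx R e) mu -> theta <= mu).

Definition clique (T : finType) (e : rel T) (C : {set T}) : Prop :=
  forall x y, x \in C -> y \in C -> x != y -> e x y.

Definition delsarte_clique (R : rcfType) (T : finType) (e : rel T) (k : nat)
    (theta : R) (C : {set T}) : Prop :=
  clique e C /\ (#|C|%:R : R) = 1 + k%:R / (- theta).

Definition geometric (R : rcfType) (T : finType) (e : rel T) (k : nat) : Prop :=
  exists theta : R, min_eigenvalue e theta /\
  exists S : {set {set T}},
    (forall C, C \in S -> delsarte_clique e k theta C) /\
    (forall x y, e x y -> #|[set C in S | (x \in C) && (y \in C)]| = 1%N).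

(* Main.v *)
(* Call a maximal clique of size at least lambda + 2 - (m - 1)(mu - 1) a line, where
   m = floor((2b + 4) / (2b + 3) r).  By Bonferroni, no vertex neighbourhood has m + 1
   independent vertices, and since the lines on x missing an independent set of
   neighbours of x can each contribute one more vertex to it, every edge lies in exactly
   one line and every vertex on at most m lines.

   Let U be the cosine matrix of the eigenvalue -r; then U^2 = c U with c <= 3/2.  The
   form of U on a clique L gives |L| <= beta + 1, and U kills the indicator of L in case
   of equality.  Let S be the set of shorter lines and Bad the set of vertices on more
   than r lines; the lines in S lie inside Bad.  For v in the image of U,
   sum_L <v, L>^2 = sum_x (t_x - r) v_x^2, where t_x counts the lines on x, so v vanishes
   on Bad as soon as it is orthogonal to the lines in S.  Hence the block of U on Bad
   has rank at most |S|, trace |Bad| and squared norm at most c |Bad|, so that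
   |Bad| <= c |S|.  Counting incidences between S and Bad the other way shows that S is
   empty, because lines are much longer than m.  So all lines have beta + 1 = 1 + k / r
   vertices, and A + r I = N N^T makes -r the smallest eigenvalue. *)
Require Import Defs.
From mathcomp Require Import all_boot all_order all_algebra.
From mathcomp Require Import zify ring lra.
Set Implicit Arguments. Unset Strict Implicit. Unset Printing Implicit Defensive.
Import Order.TTheory GRing.Theory Num.Theory.
Local Open Scope ring_scope.

(** * Independent sets in a neighbourhood *)

Section LocalIndependence.
Local Open Scope nat_scope.

Lemma leq_card_bigcup (T I : finType) (A : {set I}) (F : I -> {set T}) c :
  (forall i, i \in A -> #|F i| <= c) -> #|\bigcup_(i in A) F i| <= #|A| * c.
Proof.
move=> hF; rewrite -sum_nat_const.
elim/big_rec2: _ => [|i s B iA IH]; first by rewrite cards0.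
by apply: leq_trans (leq_card_setU _ _) _; rewrite leq_add // hF.
Qed.

Lemma subset_of_card (T : finType) (A : {set T}) n :
  n <= #|A| -> exists2 B : {set T}, B \subset A & #|B| = n.
Proof.
elim: n => [|n IH] hn; first by exists set0; rewrite ?sub0set ?cards0.
have [B sBA cB] := IH (ltnW hn).
have [x /setDP[xA xB]] : exists x, x \in A :\: B.
  by apply/set0Pn; rewrite -card_gt0 cardsDS // cB subn_gt0.
by exists (x |: B); rewrite ?subUset ?sub1set ?xA // cardsU1 xB cB.
Qed.

(** Sets are added one at a time: a new one brings at least [l] points, less at most [mu] for each
    earlier set that it may meet, and the pairs total ['C(size s, 2)]. *)
Lemma bonferroni (T I : finType) (B : I -> {set T}) (X : {set T}) l mu (s : seq I) :
  (forall i, i \in s -> B i \subset X) ->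
  (forall i, i \in s -> l <= #|B i|) ->
  (forall i j, i \in s -> j \in s -> i != j -> #|B i :&: B j| <= mu) -> uniq s ->
  size s * l <= #|X| + 'C(size s, 2) * mu.
Proof.
move=> hX hl hmu us.
pose U t := \bigcup_(i <- t) B i.
(* The induction runs over subsequences of [s], so that the hypotheses on members of [s] stay
   available. *)
suff H t : subseq t s -> size t * l <= #|U t| + 'C(size t, 2) * mu.
  apply: leq_trans (H s (subseq_refl s)) _; rewrite leq_add2r.
  apply: subset_leq_card; rewrite /U.
  elim: (s) hX => [|i t IH] hs; first by rewrite big_nil sub0set.
  rewrite big_cons subUset hs ?mem_head //= IH // => j jt.
  by apply: hs; rewrite inE jt orbT.
elim: t => [|i t IH] ht //.
have ut : uniq (i :: t) by apply: subseq_uniq ht us.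
have ms : {subset i :: t <= s} by apply: mem_subseq.
have /IH {}IH : subseq t s by apply: subseq_trans ht; apply: subseq_cons.
rewrite /U big_cons -/(U t) /= binS bin1 mulSn mulnDl.
have h1 : l <= #|B i| by apply: hl; apply: ms; rewrite mem_head.
have h2 : #|B i :&: U t| <= size t * mu.
  have : forall j, j \in t -> #|B i :&: B j| <= mu.
    move=> j jt; apply: hmu; rewrite ?ms ?mem_head ?inE ?jt ?orbT //.
    by apply: contraTneq jt => <-; case/andP: ut.
  rewrite /U; elim: (t) => [|j t' IH'] ht'; first by rewrite big_nil setI0 cards0.
  rewrite big_cons setIUr mulSn; apply: leq_trans (leq_card_setU _ _) _.
  rewrite leq_add ?ht' ?mem_head // IH' // => j' jt'.
  by rewrite ht' // inE jt' orbT.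
move: (cardsUI (B i) (U t)) h1 h2 IH.
move: (_ * l) (_ * mu) (size t * mu) #|_ :|: _| #|_ :&: _| #|B i| #|U t|.
clear; lia.
Qed.

End LocalIndependence.

(** * Lines *)

Section Lines.
Local Open Scope nat_scope.
Variables (T : finType) (e : rel T).

Definition nbrs x := [set y | e x y].
Definition indep (Y : {set T}) := [forall y in Y, forall z in Y, ~~ e y z].
Definition cliqueb (C : {set T}) := [forall x in C, forall y in C, (x != y) ==> e x y].

Lemma cliqueP C : reflect (clique e C) (cliqueb C).
Proof.
apply: (iffP 'forall_in_forall_inP) => [h x y xC yC xy | h x xC y yC].
  by have := h x xC y yC; rewrite xy.
by apply/implyP => xy; apply: h.
Qed.

Lemma indepP (Y : {set T}) : reflect {in Y &, forall y z, ~~ e y z} (indep Y).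
Proof.
by apply: (iffP 'forall_in_forall_inP) => [h y z yY zY | h y yY z zY]; apply: h.
Qed.

Hypotheses (es : symmetric e) (ei : irreflexive e).
Variables lam mu m : nat.
Hypothesis lamE : forall x y, e x y -> #|nbrs x :&: nbrs y| = lam.
Hypothesis muE : forall x y, x != y -> ~~ e x y -> #|nbrs x :&: nbrs y| <= mu.+1.

(** Bonferroni for the sets formed by [y] and the common neighbours of [x] and [y]. Two of them meet
    only in common neighbours of [y] and [z] other than [x], which leaves [mu] of the [mu.+1]
    allowed by [muE]. *)
Lemma card_indep_nbrs x Y : indep Y -> Y \subset nbrs x ->
  #|Y| * lam.+1 <= #|nbrs x| + 'C(#|Y|, 2) * mu.
Proof.
move=> /indepP iY sY.
rewrite {1 2}cardE.
apply: (@bonferroni T T (fun y => y |: (nbrs x :&: nbrs y))); rewrite ?enum_uniq // => y.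
- by rewrite mem_enum => yY; rewrite subUset sub1set (subsetP sY) //= subsetIl.
- rewrite mem_enum => yY; rewrite cardsU1 lamE; last by have := subsetP sY _ yY; rewrite inE.
  by rewrite !inE ei andbF.
move=> z; rewrite !mem_enum => yY zY yz.
have yz' : ~~ e y z by apply: iY.
have xy : e x y by have := subsetP sY _ yY; rewrite inE.
have xz : e x z by have := subsetP sY _ zY; rewrite inE.
have := muE yz yz'; rewrite (cardsD1 x) !inE es xy es xz /= add1n ltnS.
apply: leq_trans; apply: subset_leq_card; apply/subsetP => w; rewrite !inE.
case/andP=> /orP[/eqP ->|/andP[xw yw]] /orP[/eqP E|/andP[_ zw]].
- by rewrite E eqxx in yz.
- by rewrite es zw in yz'.
- by rewrite -E yw in yz'.
by rewrite yw zw !andbT; apply: contraTneq xw => ->; rewrite ei.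
Qed.

(* The indices are shifted: [mu] is c_2 - 1, and [m.+1] is the bound m of the header. *)
Hypothesis indep_bound : forall x Y, indep Y -> Y \subset nbrs x -> #|Y| <= m.+1.
Hypothesis gap : (2 * m + 1) * mu < lam.+1.

(** The size condition is kept additive because subtraction on [nat] truncates. *)
Definition lines := [set C : {set T} | maxset cliqueb C & lam.+2 <= #|C| + m * mu].
Definition lines_at x := [set C in lines | x \in C].

Lemma line_clique L : L \in lines -> clique e L.
Proof. by rewrite inE => /andP[/maxsetp/cliqueP]. Qed.

Lemma line_nonadj L y : L \in lines -> y \notin L -> exists2 z, z \in L & ~~ e y z.
Proof.
move=> LL yL; apply/exists_inP; apply: contraT; rewrite negb_exists_in => /forall_inP h.
have cL := line_clique LL; move: LL; rewrite inE => /andP[/maxsetP[_ mL] _].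
have C' : cliqueb (y |: L).
  apply/cliqueP => a b; rewrite !inE => /predU1P[-> | aL] /predU1P[-> | bL] ab.
  - by rewrite eqxx in ab.
  - by have := h b bL; rewrite negbK.
  - by rewrite es; have := h a aL; rewrite negbK.
  - exact: cL.
by have := mL _ C' (subsetUr _ _) => E; rewrite -E !inE eqxx in yL.
Qed.

(** If [z] in [L] is not adjacent to [y], every neighbour of [y] in [L] is a common neighbour of [z]
    and [y]. *)
Lemma line_nbrs_le L y : L \in lines -> y \notin L -> #|L :&: nbrs y| <= mu.+1.
Proof.
move=> LL yL; have [z zL yz] := line_nonadj LL yL.
have zy : z != y by apply: contraNneq yL => <-.
rewrite es in yz; apply: leq_trans (muE zy yz).
apply: subset_leq_card; apply/subsetP => w; rewrite !inE => /andP[wL yw].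
rewrite yw andbT; apply: (line_clique LL) => //.
by apply: contraNneq yz => ->; rewrite es.
Qed.

(** Distinct lines through an edge have a union of at most [lam.+2] vertices and an intersection of
    at most [mu.+1]. Their sizes then give [lam.+1 <= (2 * m + 1) * mu], against [gap]. *)
Lemma line_meet L L' x y : L \in lines -> L' \in lines -> x != y ->
  x \in L -> y \in L -> x \in L' -> y \in L' -> L = L'.
Proof.
move=> LL LL' xy xL yL xL' yL'; apply/eqP; apply: contraT => LnL'.
have [z zL' zL] : exists2 z, z \in L' & z \notin L.
  apply/subsetPn; apply: contraNN LnL' => sL.
  move: LL'; rewrite inE => /andP[/maxsetP[_ mL'] _].
  by apply/eqP; apply: mL' => //; apply/cliqueP/line_clique.
have h1 : #|L :&: L'| <= mu.+1.
  apply: leq_trans (line_nbrs_le LL zL); apply: subset_leq_card.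
  apply/subsetP => w; rewrite !inE => /andP[wL wL']; rewrite wL /=.
  by apply: (line_clique LL') => //; apply: contraNneq zL => ->.
have exy : e x y by apply: (line_clique LL).
have h2 : #|L :|: L'| <= lam.+2.
  have <- : #|x |: (y |: (nbrs x :&: nbrs y))| = lam.+2.
    by rewrite !cardsU1 lamE // !inE !ei (negPf xy) andbF.
  apply: subset_leq_card; apply/subsetP => w; rewrite !inE => hw.
  have [//|wx] := eqVneq w x; have [//|wy /=] := eqVneq w y.
  have [cL cL'] := (line_clique LL, line_clique LL').
  by apply/andP; split; case/orP: hw => hw;
    [apply: cL | apply: cL' | apply: cL | apply: cL']; rewrite // eq_sym.
have := cardsUI L L'; move: LL LL' gap; rewrite !inE => /andP[_ hL] /andP[_ hL'].
nia.
Qed.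

(** One vertex is taken from each line [L] of [F]. The at most [m.+1] vertices chosen so far exclude
    at most [mu] vertices each from [L :\ x], and by [gap] some vertex survives. By [line_meet] it
    lies on no other line of [F], so the hypothesis on [Y] persists. *)
Lemma greedy x (F : {set {set T}}) (Y : {set T}) :
  F \subset lines_at x -> Y \subset nbrs x -> indep Y ->
  (forall y L, y \in Y -> L \in F -> y \notin L) ->
  exists2 Z : {set T}, Z \subset nbrs x /\ indep Z & #|Z| = #|Y| + #|F|.
Proof.
elim: {F}#|F| {-2}F (erefl #|F|) Y => [|n IH] F cF Y sF sY iY hY.
  by exists Y; rewrite // cF addn0.
have [L LF] : exists L, L \in F by apply/set0Pn; rewrite -card_gt0 cF.
have := subsetP sF L LF; rewrite inE => /andP[LL xL].
have cY := indep_bound iY sY.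
have [v] : exists v, v \in (L :\ x) :\: \bigcup_(y in Y) ((L :\ x) :&: nbrs y).
  apply/set0Pn; rewrite -card_gt0 cardsDS; last first.
    by apply/bigcupsP => y _; apply: subsetIl.
  rewrite subn_gt0; apply: leq_ltn_trans (leq_card_bigcup (c := mu) _) _.
    move=> y yY; have /(line_nbrs_le LL) := hY y L yY LF.
    rewrite (cardsD1 x) !inE xL.
    have := subsetP sY _ yY; rewrite inE es => -> /=; rewrite add1n ltnS.
    by rewrite setIDAC.
  move: LL gap; rewrite inE (cardsD1 x L) xL => /andP[_]; nia.
rewrite !inE => /andP[/bigcupP hv /andP[vx vL]].
have xv : e x v by apply: (line_clique LL); rewrite // eq_sym.
have nv y : y \in Y -> ~~ e y v.
  by move=> yY; apply/negP => yv; apply: hv; exists y; rewrite // !inE vx vL.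
have vY : v \notin Y by apply/negP => /hY /(_ LF); rewrite vL.
have sFL : F :\ L \subset lines_at x by apply: subset_trans sF; apply: subsetDl.
have cFL : #|F :\ L| = n by move: cF; rewrite (cardsD1 L) LF => -[].
have [||y L'|Z hZ cZ] := IH (F :\ L) cFL (v |: Y) sFL.
- by rewrite subUset sub1set inE xv.
- apply/indepP => a b; rewrite !inE => /predU1P[-> | aY] /predU1P[-> | bY].
  + by rewrite ei.
  + by rewrite es nv.
  + exact: nv.
  + exact: (indepP _ iY).
- rewrite !inE => /predU1P[-> | yY] /andP[L'L L'F]; last exact: hY.
  apply: contraNN L'L => vL'; have := subsetP sF L' L'F; rewrite inE => /andP[LL' xL'].
  by rewrite (line_meet LL LL' vx).
exists Z => //; rewrite cZ cardsU1 vY cF cFL; lia.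
Qed.

Lemma lines_per_vertex x : #|lines_at x| <= m.+1.
Proof.
have [||y L|Z [sZ iZ] cZ] := @greedy x (lines_at x) set0 (subxx _).
- exact: sub0set.
- by apply/indepP => a b; rewrite inE.
- by rewrite inE.
by move: cZ; rewrite cards0 add0n => <-; apply: indep_bound sZ.
Qed.

(** Among [y] and the common neighbours of [x] and [y], those not adjacent to the rest of [Z] form a
    clique with [x], by maximality of [Z]. At most [m * mu] are lost, so a maximal clique containing
    it is a line. *)
Lemma max_indep_line x (Z : {set T}) y :
  Z \subset nbrs x -> indep Z ->
  (forall Y : {set T}, Y \subset nbrs x -> indep Y -> #|Y| <= #|Z|) ->
  y \in Z -> exists2 L, L \in lines_at x & y \in L.
Proof.
move=> sZ iZ mZ yZ; have cZ := indep_bound iZ sZ.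
have xy : e x y by have := subsetP sZ y yZ; rewrite inE.
pose B := y |: (nbrs x :&: nbrs y).
pose K := \bigcup_(y' in Z :\ y) (nbrs x :&: nbrs y :&: nbrs y').
have nyZ y' : y' \in Z -> ~~ e y y' by move=> y'Z; apply: (indepP _ iZ).
have cK : #|K| <= #|Z :\ y| * mu.
  apply: leq_card_bigcup => y'; rewrite !inE => /andP[y'y y'Z].
  have yy' : y != y' by rewrite eq_sym.
  have xy' : e x y' by have := subsetP sZ y' y'Z; rewrite inE.
  have := muE yy' (nyZ _ y'Z).
  rewrite (cardsD1 x) !inE es xy es xy' add1n ltnS; apply: leq_trans.
  apply: subset_leq_card; apply/subsetP => w; rewrite !inE => /andP[/andP[xw ->] ->].
  by rewrite !andbT; apply: contraTneq xw => ->; rewrite ei.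
have cB : #|B| = lam.+1 by rewrite cardsU1 lamE // !inE ei andbF.
have BKx w : w \in B :\: K -> e x w.
  by rewrite !inE => /andP[_ /predU1P[->//|/andP[]]].
have BKn w y' : w \in B :\: K -> y' \in Z :\ y -> ~~ e y' w.
  move=> + y'Z; have := y'Z; rewrite !inE => /andP[y'y y'Z'] /andP[/bigcupP wK].
  case/predU1P=> [-> | /andP[xw yw]]; first by rewrite es nyZ.
  by apply/negP => y'w; apply: wK; exists y'; rewrite // !inE xw yw.
have BKZ w : w \in B :\: K -> w \notin Z :\ y.
  rewrite !inE => /andP[_ /predU1P[->|/andP[_ yw]]]; first by rewrite eqxx.
  by apply/negP => /andP[_ /nyZ]; rewrite yw.
have cl : cliqueb (x |: (B :\: K)).
  apply/cliqueP => a b /setU1P[-> | aB] /setU1P[-> | bB] ab.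
  - by rewrite eqxx in ab.
  - exact: BKx.
  - by rewrite es BKx.
  apply: contraT => nab.
  (* Exchanging [y] for two nonadjacent vertices [a] and [b] would give a larger independent set. *)
  have := mZ (a |: (b |: (Z :\ y))); rewrite !cardsU1 [b \notin _]BKZ //.
  have -> : a \notin b |: Z :\ y by rewrite in_setU1 negb_or ab BKZ.
  rewrite (cardsD1 y Z) yZ !add1n ltnn => -> //.
    rewrite !subUset !sub1set !inE !BKx //=.
    by apply: subset_trans sZ; apply: subsetDl.
  apply/indepP => u v; rewrite !in_setU1.
  case/or3P=> [/eqP->|/eqP->|uZ] /or3P[/eqP->|/eqP->|vZ]; rewrite ?ei //.
  - by rewrite es BKn.
  - by rewrite es.
  - by rewrite es BKn.
  - exact: BKn.
  - exact: BKn.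
  by apply: (indepP _ iZ); [move: uZ | move: vZ]; rewrite inE => /andP[].
have [L mL sL] := maxset_exists cl.
have yB : y \in B :\: K.
  rewrite !inE eqxx andbT; apply/bigcupP => -[y' _].
  by rewrite !inE ei andbF.
exists L; last by apply: (subsetP sL); rewrite inE yB orbT.
rewrite !inE mL (subsetP sL) ?inE ?eqxx //= andbT.
have := subset_leq_card sL; rewrite cardsU1 => h1.
have : x \notin B :\: K by apply/negP => /BKx; rewrite ei.
move=> xB; rewrite xB in h1.
have h2 : #|B| <= #|B :\: K| + #|K|.
  by rewrite -(cardsID K B) addnC leq_add2l subset_leq_card ?subsetIr.
move: cK cZ; rewrite (cardsD1 y Z) yZ; nia.
Qed.

(** Uniqueness is [line_meet]. If no line joined [x] to [y], [greedy] started at [y] would give an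
    independent set larger than [lines_at x]; but a maximum independent set [Z] injects into
    [lines_at x], since each of its members is on such a line and no line holds two. *)
Lemma unique_line x y : e x y -> #|[set L in lines | (x \in L) && (y \in L)]| = 1.
Proof.
move=> xy.
have xny : x != y by apply: contraTneq xy => ->; rewrite ei.
suff [L] : exists2 L, L \in lines_at x & y \in L.
  rewrite inE => /andP[LL xL] yL; apply/eqP/cards1P; exists L.
  apply/setP => L'; rewrite in_set in_set1; apply/idP/eqP => [/and3P[LL' xL' yL']|->].
    exact: (line_meet LL' LL xny).
  by apply/and3P; split.
apply/exists_inP; apply: contraT; rewrite negb_exists_in => /forall_inP hy.
have [|||Z0 [sZ0 iZ0] cZ0] := @greedy x (lines_at x) [set y] (subxx _).
- by rewrite sub1set inE.
- by apply/indepP => a b; rewrite !inE => /eqP-> /eqP->; rewrite ei.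
- by move=> _ L /set1P-> /hy.
pose P (Z : {set T}) := (Z \subset nbrs x) && indep Z.
have P0 : P Z0 by rewrite /P sZ0.
case: (arg_maxnP (fun Z : {set T} => #|Z|) P0) => Z /andP[sZ iZ] mZ.
have hZ z : z \in Z -> exists2 L, L \in lines_at x & z \in L.
  apply: max_indep_line => // Y sY iY; apply: mZ; exact/andP.
(* The default [set0] is never taken for [z] in [Z], by [hZ]. *)
pose g z := odflt set0 [pick L in lines_at x | z \in L].
have gP z : z \in Z -> g z \in lines_at x /\ z \in g z.
  move=> /hZ[L LL zL]; rewrite /g; case: pickP => [L' /andP[] //|/(_ L)].
  by rewrite LL zL.
have gi : {in Z &, injective g}.
  move=> a b aZ bZ gab; apply/eqP; apply: contraT => ab.
  have [ga aga] := gP _ aZ; have [_ bgb] := gP _ bZ.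
  have := indepP _ iZ _ _ aZ bZ; rewrite (line_clique (L := g a)) //.
    by move: ga; rewrite inE => /andP[].
  by rewrite gab.
have : #|Z| <= #|lines_at x|.
  rewrite -(card_in_imset gi); apply: subset_leq_card; apply/subsetP => L.
  by case/imsetP => z zZ ->; have [] := gP _ zZ.
by move/(leq_trans (mZ _ P0)); rewrite cZ0 cards1 add1n ltnn.
Qed.

End Lines.

(** * Ranks *)

Lemma sum_enum_val (V : nmodType) (T : finType) (F : T -> V) :
  \sum_x F x = \sum_(i < #|T|) F (enum_val i).
Proof. by rewrite -(big_enum_val F); apply: eq_bigl. Qed.

Section RankBound.
Variable R : realFieldType.

(** A row vector [v] killed by the Gram matrix makes the squared norm of [v *m B] zero. *)
Lemma gram_unitmx m n (B : 'M[R]_(m, n)) : row_free B -> B *m B^T \in unitmx.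
Proof.
move=> fB; rewrite -row_free_unit -kermx_eq0; apply/rowV0P => v /sub_kermxP.
rewrite mulmxA => vBB.
have /matrixP/(_ 0 0) : v *m B *m (v *m B)^T = 0 by rewrite trmx_mul mulmxA vBB mul0mx.
rewrite mxE [RHS]mxE => /eqP.
rewrite psumr_eq0 => [/allP h|j _]; last by rewrite [_^T _ _]mxE -expr2 sqr_ge0.
have vB : v *m B = 0.
  apply/rowP => j; have := h j (mem_index_enum _); rewrite [_^T _ _]mxE /= -expr2 [RHS]mxE.
  by rewrite sqrf_eq0 => /eqP.
by apply/(row_free_inj fB); rewrite vB mul0mx.
Qed.

(* The Frobenius product of [H] with the orthogonal projection [P] onto its row
   space is [\tr H], and [P] has squared norm [\rank H]. *)
Lemma mxtrace_rank_le n (H : 'M[R]_n) (c : R) :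
  c * \tr H *+ 2 <= \sum_i \sum_j H i j ^+ 2 + c ^+ 2 * (\rank H)%:R.
Proof.
have [B uB sHB] : exists2 B : 'M_(\rank H, n), B *m B^T \in unitmx & (H <= B)%MS.
  by exists (row_base H); rewrite ?gram_unitmx ?row_base_free ?eq_row_base.
pose P := B^T *m invmx (B *m B^T) *m B.
have HP : H *m P = H.
  have /submxP[X EX] := sHB; rewrite [in LHS]EX [RHS]EX.
  by rewrite /P -!mulmxA (mulmxA B B^T) (mulmxA (B *m B^T)) mulmxV // mul1mx.
have PT : P^T = P.
  by rewrite /P !trmx_mul trmx_inv trmx_mul !trmxK mulmxA.
have PE i j : P i j = P j i by rewrite -{1}PT mxE.
have PP : P *m P = P.
  by rewrite /P -!mulmxA (mulmxA B B^T) (mulmxA (B *m B^T)) mulmxV // mul1mx.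
have trP : \tr P = (\rank H)%:R.
  by rewrite /P mxtrace_mulC mulmxA mulmxV // mxtrace1.
have : 0 <= \sum_i \sum_j (H i j - c * P i j) ^+ 2.
  by apply: sumr_ge0 => i _; apply: sumr_ge0 => j _; apply: sqr_ge0.
have e1 : \sum_i \sum_j H i j * P i j = \tr H.
  rewrite -{2}HP; apply: eq_bigr => i _; rewrite [RHS]mxE; apply: eq_bigr => j _.
  by rewrite (PE j i).
have e2 : \sum_i \sum_j P i j ^+ 2 = \tr P.
  rewrite -{2}PP; apply: eq_bigr => i _; rewrite [RHS]mxE; apply: eq_bigr => j _.
  by rewrite (PE j i) expr2.
suff -> : \sum_i \sum_j (H i j - c * P i j) ^+ 2 =
    \sum_i \sum_j H i j ^+ 2 - c * \tr H *+ 2 + c ^+ 2 * (\rank H)%:R.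
  by lra.
rewrite -trP -e1 -e2 -mulr_natr !mulr_sumr mulr_suml -sumrB -big_split /=.
apply: eq_bigr => i _; rewrite !mulr_sumr mulr_suml -sumrB -big_split /=.
by apply: eq_bigr => j _; ring.
Qed.

(** [W] keeps the columns of [U] indexed by [B]; its left kernel contains that of [G], so its rank
    is at most [#|S|]. [H] is the block of [U] on [B] padded with zeros, with trace [#|B|] and
    squared norm at most [c * #|B|]. [mxtrace_rank_le] then reads [2 c |B| <= c |B| + c^2 |S|]. *)
Lemma card_le_span (T I : finType) (S : {set I}) (B : {set T}) (U : T -> T -> R)
    (f : I -> T -> R) (c : R) : 0 < c ->
  (forall x, U x x = 1) -> (forall x, \sum_y U x y ^+ 2 <= c) ->
  (forall a : T -> R, (forall L, L \in S -> \sum_y a y * f L y = 0) ->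
     forall x, x \in B -> \sum_y a y * U y x = 0) ->
  #|B|%:R <= c * #|S|%:R.
Proof.
move=> c0 U1 Uc hspan.
pose W : 'M[R]_#|T| := \matrix_(i, j) (U (enum_val i) (enum_val j) *+ (enum_val j \in B)).
pose G : 'M[R]_(#|T|, #|S|) := \matrix_(i, j) f (enum_val j) (enum_val i).
pose H : 'M[R]_#|T| := \matrix_(i, j) (W i j *+ (enum_val i \in B)).
have kGW : (kermx G <= kermx W)%MS.
  apply/rV_subP => v /sub_kermxP vG; apply/sub_kermxP/rowP => j; rewrite !mxE.
  have [jB|jB] := boolP (enum_val j \in B); last first.
    by rewrite big1 // => i _; rewrite mxE (negPf jB) mulr0.
  transitivity (\sum_y v 0 (enum_rank y) * U y (enum_val j)).
    rewrite [RHS]sum_enum_val.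
    by apply: eq_bigr => i _; rewrite mxE jB enum_valK.
  apply: hspan jB => L LS.
  have /rowP/(_ (enum_rank_in LS L)) := vG; rewrite mxE [RHS]mxE => GE.
  rewrite -[RHS]GE [LHS]sum_enum_val.
  by apply: eq_bigr => i _; rewrite mxE enum_valK enum_rankK_in.
have rWG : (\rank W <= \rank G)%N.
  have := mxrankS kGW; rewrite !mxrank_ker; have := rank_leq_row W.
  have := rank_leq_row G; lia.
have rH : (\rank H <= #|S|)%N.
  apply: leq_trans (leq_trans rWG (rank_leq_col G)).
  have -> : H = diag_mx (\row_i (enum_val i \in B)%:R) *m W.
    by apply/matrixP => i j; rewrite mul_diag_mx !mxE mulr_natl.
  exact: mxrankM_maxr.
have trH : \tr H = #|B|%:R.
  rewrite /mxtrace (eq_bigr (fun i => (enum_val i \in B)%:R)) => [|i _].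
    rewrite -(sum_enum_val (fun x => (x \in B)%:R)).
    rewrite -sum1_card natr_sum [RHS]big_mkcond /=.
    by apply: eq_bigr => x _; case: (x \in B).
  by rewrite !mxE U1; case: (_ \in B).
have nH : \sum_i \sum_j H i j ^+ 2 <= c * #|B|%:R.
  have -> : c * #|B|%:R = \sum_(i < #|T|) c *+ (enum_val i \in B).
    rewrite -(sum_enum_val (fun x => c *+ (x \in B))).
    by rewrite -sum1_card natr_sum mulr_sumr big_mkcond /=;
      apply: eq_bigr => x _; case: (x \in B); rewrite ?mulr1.
  apply: ler_sum => i _.
  have [iB|iB] := boolP (enum_val i \in B); last first.
    by rewrite big1 // => j _; rewrite mxE (negPf iB) expr0n.
  apply: le_trans (Uc (enum_val i)).
  rewrite [leRHS]sum_enum_val.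
  apply: ler_sum => j _; rewrite !mxE iB.
  by case: (_ \in B); rewrite // expr0n sqr_ge0.
have := mxtrace_rank_le H c; rewrite trH.
have : c ^+ 2 * (\rank H)%:R <= c ^+ 2 * #|S|%:R :> R.
  by rewrite ler_wpM2l ?sqr_ge0 // ler_nat.
have -> : c ^+ 2 * #|S|%:R = c * (c * #|S|%:R) by ring.
move=> h1 h2; rewrite -(ler_pM2l c0); rewrite mulr2n in h2; lra.
Qed.

End RankBound.

(** * Distances *)

Section Distance.
Local Open Scope nat_scope.
Variables (T : finType) (e : rel T).

(** The value would be [D.+1] if no ball of radius at most [D] contained [y]; in a [drg] of diameter
    [D] this does not occur. *)
Definition gdist D x y := find (fun i => y \in ball e i x) (iota 0 D.+1).

Lemma ball_mono x i j : i <= j -> ball e i x \subset ball e j x.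
Proof.
move=> /subnK <-; elim: (j - i) => [|n IH] //.
by rewrite addSn /=; apply: subset_trans IH (subsetUl _ _).
Qed.

(** [ball] grows at its outer end; moving the centre instead is what the symmetry of distance
    needs. *)
Lemma ball_edge x y z i : e x y -> z \in ball e i y -> z \in ball e i.+1 x.
Proof.
elim: i z => [|i IH] z xy /=.
  rewrite !inE => /eqP ->; apply/orP; right; apply/exists_inP.
  by exists x; rewrite ?inE.
rewrite inE => /orP[/(IH _ xy) zx|].
  by rewrite in_setU zx.
rewrite inE => /exists_inP[w wy wz]; rewrite in_setU; apply/orP; right.
by rewrite inE; apply/exists_inP; exists w => //; apply: (IH _ xy).
Qed.

Lemma ball_sym : symmetric e -> forall i x y, (y \in ball e i x) = (x \in ball e i y).
Proof.
move=> es; suff H i x y : y \in ball e i x -> x \in ball e i y.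
  by move=> i x y; apply/idP/idP; apply: H.
elim: i y => [|i IH] y /=; first by rewrite !inE eq_sym.
rewrite inE => /orP[/IH|]; first by rewrite in_setU => ->.
rewrite inE => /exists_inP[w /IH xw wy].
by apply: (ball_edge _ xw); rewrite es.
Qed.

Variables (D : nat) (bn cn : nat -> nat).
Hypothesis G : drg e D bn cn.
Local Notation d := (gdist D).

Lemma in_ball i x y : (y \in ball e i x) = (d x y <= i).
Proof.
have [_ hD _ _ _] := G.
have hh : has (fun i => y \in ball e i x) (iota 0 D.+1).
  by apply/hasP; exists D; rewrite ?mem_iota ?leqnn.
have hd : d x y < D.+1 by rewrite -[X in _ < X](size_iota 0) -has_find.
have hb : y \in ball e (d x y) x by have := nth_find 0 hh; rewrite nth_iota.
apply/idP/idP => [yi|di]; last exact: subsetP (ball_mono x di) _ hb.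
rewrite leqNgt; apply/negP => id.
have := before_find 0 id; rewrite nth_iota ?add0n ?yi //.
exact: ltn_trans id hd.
Qed.

Lemma dist_eqE i x y : dist_eq e i x y = (d x y == i).
Proof. by rewrite /dist_eq !in_ball; case: i => [|i] /=; [rewrite leqn0 andbT | lia]. Qed.

Lemma gdist_le x y : d x y <= D.
Proof. by rewrite -in_ball; have [] := G. Qed.

Lemma gdist_sym x y : d x y = d y x.
Proof.
have [[es _] _ _ _ _] := G.
by apply/eqP; rewrite eqn_leq -!in_ball (ball_sym es) in_ball leqnn (ball_sym es) in_ball /=.
Qed.

Lemma gdist_eq0 x y : (d x y == 0) = (x == y).
Proof. by rewrite -leqn0 -in_ball inE eq_sym. Qed.

Lemma gdist_eq1 x y : (d x y == 1) = e x y.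
Proof.
have [[_ ei] _ _ _ _] := G.
rewrite -dist_eqE /dist_eq /= !inE; have [->|xy] := eqVneq y x; rewrite /= ?ei // andbT.
by apply/exists_inP/idP => [[w /set1P ->]//|exy]; exists x; rewrite ?inE.
Qed.

Lemma gdist_step x y z : e y z -> d x z <= (d x y).+1.
Proof.
move=> yz; rewrite -in_ball /= inE; apply/orP; right; rewrite inE.
by apply/exists_inP; exists y; rewrite // in_ball.
Qed.

Lemma card_up x y : d x y < D -> #|[set z | e y z && (d x z == (d x y).+1)]| = bn (d x y).
Proof.
have [_ _ _ hb _] := G => dD; rewrite -(hb _ x y dD) ?dist_eqE //.
by apply: eq_card => z; rewrite !inE dist_eqE.
Qed.

Lemma card_down x y : 0 < d x y ->
  #|[set z | e y z && ((d x z).+1 == d x y)]| = cn (d x y).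
Proof.
have [_ _ _ _ hc] := G => d0.
rewrite -(hc (d x y) x y) ?dist_eqE ?d0 ?gdist_le //.
by apply: eq_card => z; rewrite !inE dist_eqE; case: (d x y) d0.
Qed.

Lemma card_nbrs x : 0 < D -> #|nbrs e x| = bn 0.
Proof.
have xx : d x x = 0 by apply/eqP; rewrite gdist_eq0.
move=> D0; have := @card_up x x; rewrite xx => /(_ D0) <-.
by apply: eq_card => z; rewrite !inE gdist_eq1 andbb.
Qed.

(** From a pair at distance [D], the second vertex is moved one step at a time towards the first. *)
Lemma exists_gdist i : i <= D -> exists x y, d x y = i.
Proof.
move=> iD; have [[es _] _ [x [y]]] := G; rewrite dist_eqE => /eqP dxy _ _.
exists x; rewrite -{iD}(subKn iD); elim: (D - i) => [|n [z dz]].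
  by exists y; rewrite subn0.
have [z0|z0] := posnP (d x z); first by exists z; lia.
have : z \in ball e (d x z) x by rewrite in_ball.
case E: (d x z) z0 => [//|j] _ /=; rewrite inE in_ball E ltnn /= inE.
case/exists_inP => w; rewrite in_ball => wj wz; exists w.
by have := gdist_step x wz; lia.
Qed.

Lemma cn_gt0 i : 0 < i <= D -> 0 < cn i.
Proof.
case/andP=> i0 iD; have [[es _] _ _ _ _] := G.
have [x [y dxy]] := exists_gdist iD.
rewrite -dxy -card_down ?dxy // card_gt0; apply/set0Pn.
have : y \in ball e i x by rewrite in_ball dxy.
case: i i0 dxy {iD} => // i _ dxy /=; rewrite inE in_ball dxy ltnn /= inE.
case/exists_inP => w; rewrite in_ball => wi wy; exists w; rewrite inE es wy /=.
by have := gdist_step x wy; rewrite dxy; lia.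
Qed.

Lemma nonadj_nbrs x y : x != y -> ~~ e x y -> #|nbrs e x :&: nbrs e y| <= cn 2.
Proof.
have [[es _] _ _ _ _] := G.
rewrite -gdist_eq0 -gdist_eq1 => d0 d1.
have [d2|d2] := eqVneq (d x y) 2%N.
  rewrite -d2 -card_down ?d2 // subset_leq_card //.
  by apply/subsetP => z; rewrite !inE eqSS gdist_eq1 andbC.
rewrite (_ : _ :&: _ = set0) ?cards0 //; apply/setP => z; rewrite !inE.
apply/negP => /andP[xz]; rewrite es => zy.
have := gdist_step x zy; rewrite -gdist_eq1 in xz; rewrite (eqP xz); lia.
Qed.

End Distance.

(** * The eigenvalue -r *)

Section Spectral.
Variables (R : realFieldType) (T : finType) (e : rel T) (D : nat) (bn cn : nat -> nat).
Variables (b : int) (alpha beta : R).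
Hypotheses (G : drg e D bn cn) (H : classical_params D bn cn b alpha beta).
Hypotheses (b2 : 2 <= b) (D0 : (0 < D)%N).
Local Notation d := (gdist e D).
Local Notation q := (qnum R b).
Local Notation r := (q D).

Let bb2 : 2 <= b%:~R :> R.
Proof. by have := b2; rewrite -(ler_int R). Qed.

Lemma qnum0 : q 0 = 0. Proof. by rewrite /qnum expr0 subrr mul0r. Qed.

Lemma qnumS i : q i.+1 = b%:~R * q i + 1.
Proof.
have b1 : b%:~R - 1 != 0 :> R by apply: lt0r_neq0; have := bb2; lra.
by rewrite /qnum exprS; field.
Qed.

Lemma qnum_ge0 i : 0 <= q i.
Proof. by elim: i => [|i IH]; rewrite ?qnum0 // qnumS; have := bb2; nra. Qed.

Lemma qnum_gt0 i : 0 < q i.+1.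
Proof. by rewrite qnumS; have := qnum_ge0 i; have := bb2; nra. Qed.

Lemma qnum_leS i : 2 * q i + 1 <= q i.+1.
Proof. by rewrite qnumS; have := qnum_ge0 i; have := bb2; nra. Qed.

Lemma qnum_le i j : (i <= j)%N -> q i <= q j.
Proof.
move=> /subnK <-; elim: (j - i)%N => [|n IH] //; apply: le_trans IH _.
by rewrite addSn; have := qnum_leS (n + i); have := qnum_ge0 (n + i); lra.
Qed.

Let B i := (r - q i) * (beta - alpha * q i).
Let C i := q i * (1 + alpha * q i.-1).

Lemma bnE i : (i < D)%N -> (bn i)%:R = B i.
Proof. by have [_ [hb _]] := H => iD; apply: hb; clear -iD; lia. Qed.

Lemma cnE i : (0 < i <= D)%N -> (cn i)%:R = C i.
Proof. by have [_ [_ hc]] := H => iD; rewrite hc // subn1. Qed.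

(** The tridiagonal action of adjacency on functions of the distance from [x]. The formulas give
    [B D = 0] and [C 0 = 0], so both ends need no separate statement. *)
Lemma nbrs_gdist_sum (F : nat -> R) x y :
  \sum_(z | e y z) F (d x z) =
    B (d x y) * F (d x y).+1 + C (d x y) * F (d x y).-1
    + (r * beta - B (d x y) - C (d x y)) * F (d x y).
Proof.
have [[es ei] _ _ _ _] := G.
set i := d x y.
have up : (#|[set z | e y z && (d x z == i.+1)]|)%:R = B i.
  have := gdist_le G x y; rewrite leq_eqVlt => /predU1P[iD|iD].
    rewrite [B i]/B /i iD subrr mul0r; apply/eqP; rewrite pnatr_eq0 cards_eq0.
    apply/eqP/setP => z; rewrite !inE; apply/negP => /andP[_ /eqP E].
    by have := gdist_le G x z; rewrite E ltnn.
  by rewrite (card_up G) // bnE.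
have down : (#|[set z | e y z && ((d x z).+1 == i)]|)%:R = C i.
  have [i0|i0] := posnP i; last by rewrite (card_down G) // cnE // i0 (gdist_le G).
  rewrite i0 /C qnum0 mul0r; apply/eqP; rewrite pnatr_eq0 cards_eq0.
  by apply/eqP/setP => z; rewrite !inE andbF.
have k : (#|nbrs e y|)%:R = r * beta :> R.
  by rewrite (card_nbrs G) // bnE // /B qnum0 mulr0 !subr0.
have cardE (P : pred T) : (#|[set z | e y z && P z]|)%:R = \sum_(z | e y z) (P z)%:R :> R.
  rewrite -sum1_card natr_sum big_mkcond [RHS]big_mkcond /=; apply: eq_bigr => z _.
  by rewrite !inE; case: (e y z); case: (P z).
have kE : r * beta = \sum_(z | e y z) 1.
  rewrite -k -sum1_card natr_sum; apply: eq_bigl => z; by rewrite inE.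
(* Both sides become sums over the neighbours of [y] and agree term by term. *)
rewrite -up -down kE !cardE -!sumrB !mulr_suml -!big_split /=.
apply: eq_bigr => z yz.
have h1 : (d x z <= i.+1)%N by apply: (gdist_step G).
have h2 : (i <= (d x z).+1)%N by apply: (gdist_step G); rewrite es.
have : d x z = i.+1 \/ d x z = i \/ (d x z).+1 = i by lia.
case=> [->|[->|E]].
- have -> : (i.+2 == i) = false by lia.
  by rewrite eqxx mulr1n mulr0n; ring.
- have -> : (i == i.+1) = false by lia.
  have -> : (i.+1 == i) = false by lia.
  by rewrite !mulr0n; ring.
have -> : (d x z == i.+1) = false by lia.
by rewrite E eqxx -[in F i.-1]E mulr1n mulr0n /=; ring.
Qed.

Hypothesis alpha0 : 0 <= alpha.
Hypothesis beta_large : 12 * (alpha * r) + 8 * r <= beta.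

Lemma qnum_bounds i : (i <= D)%N ->
  [/\ 0 <= q i, q i <= r, 0 <= alpha * q i & alpha * q i <= alpha * r].
Proof.
by move=> iD; rewrite qnum_ge0 qnum_le // mulr_ge0 ?qnum_ge0 // ler_wpM2l ?qnum_le.
Qed.

Lemma r_gt0 : 0 < r.
Proof. by case: D D0 => // n _; apply: qnum_gt0. Qed.

Lemma beta_gap i : (i <= D)%N -> 0 < beta - alpha * q i.
Proof. by move=> /qnum_bounds[? ? ? ?]; move: r_gt0 beta_large; lra. Qed.

Lemma beta_gt0 : 0 < beta.
Proof. by have := beta_gap (leq0n D); rewrite qnum0 mulr0 subr0. Qed.

(* The cosine sequence of [- r], with [cos_seq D.+1] a junk value; [sphere_sum] below shows
   that the distance-[i] matrix acts on the [- r]-eigenspace as [mult_seq i]. *)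
Fixpoint cos_seq i : R :=
  if i is i'.+1 then - ((1 + alpha * q i') / (beta - alpha * q i')) * cos_seq i' else 1.

Fixpoint mult_seq i : R :=
  if i is i'.+1 then - ((r - q i') / q i'.+1) * mult_seq i' else 1.

Lemma cos_seqS i : (i <= D)%N ->
  (beta - alpha * q i) * cos_seq i.+1 = - (1 + alpha * q i) * cos_seq i.
Proof. by move=> /beta_gap/lt0r_neq0 nz /=; field. Qed.

Definition U x y := cos_seq (d x y).

Lemma U_diag x : U x x = 1.
Proof. by rewrite /U (_ : d x x = 0%N) //; apply/eqP; rewrite (gdist_eq0 G). Qed.

Lemma U_sym x y : U x y = U y x.
Proof. by rewrite /U (gdist_sym G). Qed.

Lemma U_edge x y : e x y -> U x y = - beta^-1.
Proof.
by rewrite -(gdist_eq1 G) /U => /eqP-> /=; rewrite qnum0 !mulr0 addr0 subr0 mulr1 mul1r.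
Qed.

(** The first-order recurrence [cos_seqS] turns each term of [nbrs_gdist_sum] into a multiple of the
    cosine at [d x y], and the multiples add up to [- r]. *)
Lemma U_eigen x y : \sum_(z | e y z) U x z = - r * U x y.
Proof.
rewrite (nbrs_gdist_sum cos_seq) /U; have := gdist_le G x y.
case: (d x y) => [|i] iD; rewrite /B /C.
  have := cos_seqS (leq0n D); rewrite qnum0 [cos_seq 0]/=.
  move: (cos_seq 1) => u1 E.
  have -> : (r - 0) * (beta - alpha * 0) * u1 = r * (- (1 + alpha * 0) * 1).
    by rewrite -E; ring.
  by ring.
have h1 := cos_seqS iD; have h2 := cos_seqS (ltnW iD).
rewrite [_.-1]/=; move: h1 h2.
move: (cos_seq i.+2) (cos_seq i.+1) (cos_seq i) (q i.+1) (q i) => u2 u1 u0 q1 q0 h1 h2.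
have -> : q1 * (1 + alpha * q0) * u0 = - (q1 * ((beta - alpha * q0) * u1)).
  by rewrite h2; ring.
have -> : (r - q1) * (beta - alpha * q1) * u2 = (r - q1) * (- (1 + alpha * q1) * u1).
  by rewrite -h1; ring.
by ring.
Qed.

(** * Sums of an eigenvector over spheres *)

Section Sphere.
Variable v : T -> R.
Hypothesis eigen_v : forall y, \sum_(z | e y z) v z = - r * v y.

Let S i y := \sum_(z | d y z == i) v z.

(** The eigenvalue equation is summed over the sphere of radius [i] about [y], and the order of
    summation is exchanged. *)
Lemma sphere_rec i y : (i < D)%N ->
  - r * S i y = B i.-1 * S i.-1 y *+ (0 < i) + C i.+1 * S i.+1 y
     + (r * beta - B i - C i) * S i y.
Proof.
move=> iD; have [[es ei] _ _ _ _] := G.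
transitivity (\sum_z v z * \sum_(z' | e z z') (d y z' == i)%:R).
  rewrite mulr_sumr big_mkcond /=.
  transitivity (\sum_z' \sum_z (if e z' z then v z * (d y z' == i)%:R else 0)).
    apply: eq_bigr => z' _; rewrite -big_mkcond -mulr_suml eigen_v.
    by case: (d y z' == i); rewrite ?mulr1 ?mulr0.
  rewrite exchange_big; apply: eq_bigr => z _; rewrite mulr_sumr [RHS]big_mkcond.
  by apply: eq_bigr => z' _; rewrite es.
have -> : B i.-1 * S i.-1 y *+ (0 < i) =
    \sum_z v z * (B (d y z) * ((d y z).+1 == i)%:R).
  rewrite /S mulr_sumr big_mkcond -sumrMnl; apply: eq_bigr => z _.
  case: i {iD} => [|i] /=; first by rewrite !mulr0 mulr0n.
  by rewrite eqSS; case: eqP => [->|_]; rewrite mulr1n ?mulr1 ?mulr0 // mulrC.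
have -> : C i.+1 * S i.+1 y = \sum_z v z * (C (d y z) * ((d y z).-1 == i)%:R).
  rewrite /S mulr_sumr big_mkcond; apply: eq_bigr => z _.
  have [->|] := eqVneq; first by rewrite eqxx mulr1 mulrC.
  case: (d y z) => [|j] /=; first by rewrite /C qnum0 !mul0r mulr0.
  by rewrite eqSS => /negPf->; rewrite !mulr0.
have -> : (r * beta - B i - C i) * S i y =
    \sum_z v z * ((r * beta - B (d y z) - C (d y z)) * (d y z == i)%:R).
  rewrite /S mulr_sumr big_mkcond; apply: eq_bigr => z _.
  by case: eqP => [->|_]; rewrite ?mulr1 ?mulr0 // mulrC.
rewrite -!big_split; apply: eq_bigr => z _ /=.
by rewrite (nbrs_gdist_sum (fun j => (j == i)%:R)) !mulrDr.
Qed.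

(** The induction hypothesis eliminates [S i y] from the three-term recurrence; what remains has the
    common factor [1 + alpha * q i.+1], positive since [alpha] is nonnegative. *)
Lemma sphere_step i y : (i < D)%N -> q i.+1 * S i.+1 y = - (r - q i) * S i y.
Proof.
elim: i => [|i IH] iD.
  have := sphere_rec y iD; rewrite mulr0n add0r /B /C /= qnum0 => h; lra.
have {IH} := IH (ltnW iD); have := sphere_rec y iD; rewrite /= mulr1n /B /C /=.
have [_ _ a0 _] := qnum_bounds (ltnW iD).
move: a0; move: (S i.+2 y) (S i.+1 y) (S i y) (q i.+2) (q i.+1) (q i) => s2 s1 s0 q2 q1 q0.
move=> a0 h1 h2; apply: (mulfI (x := 1 + alpha * q1)); first by apply: lt0r_neq0; lra.
have E : (r - q0) * (beta - alpha * q0) * s0 = - (beta - alpha * q0) * (q1 * s1).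
  by rewrite h2; ring.
rewrite E in h1; lra.
Qed.

Lemma sphere_sum i y : (i <= D)%N -> S i y = mult_seq i * v y.
Proof.
elim: i => [|i IH] iD.
  by rewrite /S (eq_bigl (pred1 y)) ?big_pred1_eq ?mul1r // => z; rewrite (gdist_eq0 G) eq_sym.
have nz := lt0r_neq0 (qnum_gt0 i).
by apply: (mulfI nz); rewrite sphere_step // IH ?(ltnW iD) //=; field.
Qed.

(** The scalar by which [U] acts on the [- r]-eigenspace. As the rows of [U] lie there, it is the
    constant [c] in [U^2 = c U]. *)
Definition normU : R := \sum_(i < D.+1) cos_seq i * mult_seq i.

Lemma U_mul y : \sum_z U y z * v z = normU * v y.
Proof.
rewrite /normU mulr_suml.
transitivity (\sum_(i < D.+1) \sum_(z | d y z == i) cos_seq i * v z); last first.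
  by apply: eq_bigr => i _; rewrite -mulr_sumr -/(S i y) sphere_sum ?mulrA // -ltnS.
rewrite (exchange_big_dep predT) //=; apply: eq_bigr => z _.
rewrite (big_pred1 (Ordinal (gdist_le G y z : (d y z < D.+1)%N))) //.
Qed.

End Sphere.

(** The signs of the two recurrences cancel, and [beta_large] is calibrated to keep the ratio of
    consecutive terms of [normU] at most [1 / 3]. *)
Lemma cos_mult_step i : (i < D)%N -> 0 <= cos_seq i * mult_seq i ->
  0 <= cos_seq i.+1 * mult_seq i.+1 <= cos_seq i * mult_seq i / 3.
Proof.
move=> iD t0 /=; have [q0 qr aq aqr] := qnum_bounds (ltnW iD).
have g0 := beta_gap (ltnW iD); have p0 := qnum_gt0 i; have r0 := r_gt0.
set t := cos_seq i * mult_seq i in t0 *.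
rewrite (_ : _ * _ * _ = t * (((1 + alpha * q i) * (r - q i)) / ((beta - alpha * q i) * q i.+1)));
  last by rewrite /t; field; rewrite !lt0r_neq0.
apply/andP; split.
  by apply: mulr_ge0 => //; apply: divr_ge0; apply: mulr_ge0; lra.
rewrite ler_wpM2l // ler_pdivrMr; last exact: mulr_gt0.
have q1 := qnum_leS i; have bl := beta_large; have a0 := alpha0.
have h1 : (beta - alpha * q i) * (2 * q i + 1) <= (beta - alpha * q i) * q i.+1.
  by apply: ler_wpM2l => //; lra.
have h2 : (11 * (alpha * r) + 8 * r) * (2 * q i + 1) <= (beta - alpha * q i) * (2 * q i + 1).
  by apply: ler_wpM2r; lra.
have h3 : (1 + alpha * q i) * (r - q i) <= (1 + alpha * q i) * r.
  by apply: ler_wpM2l; lra.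
have h4 : 0 <= alpha * r * q i by rewrite mulr_ge0 //; lra.
have h5 : 0 <= r * q i by apply: mulr_ge0; lra.
suff : 3 * ((1 + alpha * q i) * r) <= (11 * (alpha * r) + 8 * r) * (2 * q i + 1) by lra.
by lra.
Qed.

(** Comparison with the geometric series of ratio [1 / 3], whose sum is [3 / 2]; half of the last
    term is carried in the induction to bound the remaining tail. *)
Lemma normU_bounds : 1 <= normU <= 3 / 2.
Proof.
suff E n : (n <= D)%N -> 0 <= cos_seq n * mult_seq n /\
    1 <= \sum_(i < n.+1) cos_seq i * mult_seq i <= 3 / 2 - cos_seq n * mult_seq n / 2.
  by have [t0 /andP[h1 h2]] := E D (leqnn D); apply/andP; split; rewrite // /normU; lra.
elim: n => [|n IH] nD; first by rewrite big_ord1 /= mulr1; split; lra.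
have [t0 h] := IH (ltnW nD); have := cos_mult_step nD t0.
by rewrite big_ord_recr /=; move: t0 h; rewrite -/cos_seq -/mult_seq; lra.
Qed.

End Spectral.

(** * Line systems *)

Section LineSystem.
Variables (R : realFieldType) (T : finType) (e : rel T) (Ls : {set {set T}}).
Hypotheses (es : symmetric e) (ei : irreflexive e).
Hypothesis Ls_clique : forall L, L \in Ls -> clique e L.
Hypothesis Ls_edge : forall x y, e x y -> #|[set L in Ls | (x \in L) && (y \in L)]| = 1%N.

Definition degL x := #|[set L in Ls | x \in L]|.

Lemma lines_through x y : x != y ->
  #|[set L in Ls | (x \in L) && (y \in L)]| = e x y.
Proof.
move=> xy; have [exy|nxy] := boolP (e x y); first exact: Ls_edge.
apply/eqP; rewrite cards_eq0; apply/eqP/setP => L; rewrite !inE.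
apply/negP => /and3P[LL xL yL]; case/negP: nxy; exact: (Ls_clique LL).
Qed.

Lemma card_setR (A : {set {set T}}) (P : pred {set T}) :
  (#|[set L in A | P L]|)%:R = \sum_(L in A) (P L)%:R :> R.
Proof.
rewrite -sum1_card natr_sum big_mkcond [RHS]big_mkcond /=; apply: eq_bigr => L _.
by rewrite !inE; case: (L \in A); case: (P L).
Qed.

Lemma sum_indic (L : {set T}) (F : T -> R) : \sum_(x in L) F x = \sum_x (x \in L)%:R * F x.
Proof.
rewrite big_mkcond; apply: eq_bigr => x _.
by case: (x \in L); rewrite ?mul1r ?mul0r.
Qed.

(** This is [N N^T = diag(degL) + A] as quadratic forms, [N] being the incidence matrix of vertices
    and lines: two distinct vertices share one line if adjacent and none otherwise. *)
Lemma sum_sqr_lines (v : T -> R) :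
  \sum_(L in Ls) (\sum_(x in L) v x) ^+ 2 =
    \sum_x (degL x)%:R * v x ^+ 2 + \sum_x v x * \sum_(y | e x y) v y.
Proof.
transitivity (\sum_x \sum_y v x * v y * (#|[set L in Ls | (x \in L) && (y \in L)]|)%:R).
  transitivity (\sum_(L in Ls) \sum_x \sum_y v x * v y * ((x \in L) && (y \in L))%:R).
    apply: eq_bigr => L _; rewrite expr2 {1}sum_indic mulr_suml.
    apply: eq_bigr => x _; rewrite sum_indic mulr_sumr; apply: eq_bigr => y _.
    by case: (x \in L); case: (y \in L); rewrite /=; ring.
  rewrite exchange_big; apply: eq_bigr => x _ /=.
  rewrite exchange_big; apply: eq_bigr => y _ /=.
  by rewrite card_setR mulr_sumr.
rewrite -big_split; apply: eq_bigr => x _ /=.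
rewrite (bigD1 x) //=; congr (_ + _).
  rewrite mulrC expr2 /degL; congr (_%:R * _).
  by apply: eq_card => L; rewrite !inE andbb.
rewrite mulr_sumr big_mkcond [RHS]big_mkcond; apply: eq_bigr => y _ /=.
have [->|yx] := eqVneq y x; first by rewrite ei.
by rewrite lines_through 1?eq_sym //; case: (e x y); rewrite ?mulr1 ?mulr0.
Qed.

Lemma sum_line_sizes x :
  \sum_(L in Ls | x \in L) ((#|L|)%:R - 1) = (#|nbrs e x|)%:R :> R.
Proof.
transitivity (\sum_(L in Ls | x \in L) \sum_(y | y != x) (y \in L)%:R : R).
  apply: eq_bigr => L /andP[_ xL].
  rewrite (cardsD1 x) xL natrD addrC addKr -sum1_card natr_sum.
  rewrite big_mkcond [RHS]big_mkcond; apply: eq_bigr => y _.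
  by rewrite !inE; case: (y != x); case: (y \in L).
rewrite exchange_big /= -sum1_card natr_sum big_mkcond [RHS]big_mkcond.
apply: eq_bigr => y _; rewrite inE.
have [->|yx] /= := eqVneq y x; first by rewrite ei.
transitivity ((#|[set L in Ls | (x \in L) && (y \in L)]|)%:R : R).
  rewrite card_setR big_mkcondr; apply: eq_bigr => L _.
  by case: (x \in L).
by rewrite lines_through 1?eq_sym //; case: (e x y).
Qed.

Variables (U : T -> T -> R) (beta r c : R).
Hypothesis beta0 : 0 < beta.
Hypothesis valency : forall x, (#|nbrs e x|)%:R = r * beta.
Hypothesis U_diag : forall x, U x x = 1.
Hypothesis U_sym : forall x y, U x y = U y x.
Hypothesis U_edge : forall x y, e x y -> U x y = - beta^-1.
Hypothesis U_eigen : forall x y, \sum_(z | e y z) U x z = - r * U x y.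
Hypothesis U_idem : forall x y, \sum_z U x z * U z y = c * U x y.
Hypothesis c_bounds : 1 <= c <= 3 / 2.

Local Notation dot v L := (\sum_(x in L) v x).

(** Since [U] is symmetric with [U^2 = c U], the squared norm is [c] times the form of [U] at the
    indicator of [L], whose entries are [1] on the diagonal and [- beta^-1] off it. *)
Lemma norm_clique L : clique e L ->
  \sum_y (dot (U y) L) ^+ 2 = c * ((#|L|)%:R * (1 - ((#|L|)%:R - 1) / beta)).
Proof.
move=> cL.
transitivity (\sum_(z in L) \sum_(w in L) c * U z w).
  transitivity (\sum_y \sum_(z in L) \sum_(w in L) U z y * U y w).
    apply: eq_bigr => y _; rewrite expr2 mulr_suml; apply: eq_bigr => z _.
    by rewrite mulr_sumr; apply: eq_bigr => w _; rewrite (U_sym y z).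
  rewrite exchange_big; apply: eq_bigr => z _.
  by rewrite exchange_big; apply: eq_bigr => w _; rewrite U_idem.
transitivity (\sum_(z in L) c * (1 - ((#|L|)%:R - 1) / beta)).
  apply: eq_bigr => z zL; rewrite -mulr_sumr; congr (_ * _).
  rewrite (bigD1 z) //= U_diag; congr (_ + _).
  rewrite (eq_bigr (fun=> - beta^-1)) => [|w /andP[wL wz]]; last first.
    by apply: U_edge; apply: cL; rewrite // eq_sym.
  have -> : (#|L|)%:R - 1 = \sum_(w in L | w != z) 1 :> R.
    rewrite (cardsD1 z) zL natrD addrC addKr -sum1_card natr_sum.
    by apply: eq_bigl => w; rewrite !inE andbC.
  by rewrite mulr_suml -sumrN; apply: eq_bigr => w _; ring.
rewrite sumr_const -mulr_natl; ring.
Qed.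

Lemma clique_bound L : clique e L -> (#|L|)%:R <= beta + 1.
Proof.
move=> cL; have c0 : 0 < c by case/andP: c_bounds; lra.
have [->|L0] := posnP #|L|; first by rewrite mulr0n; move: beta0; lra.
have : 0 <= c * ((#|L|)%:R * (1 - ((#|L|)%:R - 1) / beta)).
  by rewrite -norm_clique //; apply: sumr_ge0 => y _; apply: sqr_ge0.
rewrite pmulr_rge0 // pmulr_rge0 ?ltr0n // subr_ge0 ler_pdivrMr //; lra.
Qed.

Lemma clique_tight L y : clique e L -> (#|L|)%:R = beta + 1 -> dot (U y) L = 0.
Proof.
move=> cL E; have := norm_clique cL.
rewrite E addrK divff ?lt0r_neq0 // subrr !mulr0 => /eqP.
rewrite psumr_eq0 => [/allP/(_ y (mem_index_enum _))|z _]; last exact: sqr_ge0.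
by rewrite sqrf_eq0 => /eqP.
Qed.

(** The [r * beta] neighbours of [x] are shared out among its lines, each taking at most [beta]. *)
Lemma degL_ge x : r <= (degL x)%:R.
Proof.
rewrite -(ler_pM2r beta0) -(valency x) -sum_line_sizes.
rewrite /degL -sum1_card natr_sum mulr_suml.
rewrite [leRHS](eq_bigl (fun L => (L \in Ls) && (x \in L))).
  apply: ler_sum => L /andP[LL _]; have := clique_bound (Ls_clique LL); lra.
by move=> L; rewrite inE.
Qed.

Lemma degL_eq x L : (degL x)%:R = r -> L \in Ls -> x \in L -> (#|L|)%:R = beta + 1.
Proof.
move=> E LL xL.
have : \sum_(L in Ls | x \in L) (beta + 1 - (#|L|)%:R) = 0.
  transitivity (r * beta - \sum_(L in Ls | x \in L) ((#|L|)%:R - 1)); last first.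
    by rewrite sum_line_sizes valency subrr.
  rewrite -E /degL -sum1_card natr_sum mulr_suml.
  rewrite [X in _ = X - _](eq_bigl (fun L => (L \in Ls) && (x \in L))) => [|L'].
    by rewrite -sumrB; apply: eq_bigr => L' _; ring.
  by rewrite inE.
move=> /eqP; rewrite psumr_eq0 => [/allP/(_ L (mem_index_enum _))|L' /andP[L'L _]].
  by rewrite LL xL /= subr_eq0 => /eqP.
by rewrite subr_ge0 clique_bound //; apply: Ls_clique.
Qed.

Variables (M : nat) (s : R).
Hypothesis degL_le : forall x, (degL x <= M)%N.
Hypothesis size_ge : forall L, L \in Ls -> s <= (#|L|)%:R.
Hypothesis sM : 3 / 2 * M%:R < s.

Lemma line_size L : L \in Ls -> (#|L|)%:R = beta + 1.
Proof.
pose S := [set L in Ls | (#|L|)%:R != beta + 1].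
pose Bad := [set x | (degL x)%:R != r].
have hBS : (#|Bad|)%:R <= c * (#|S|)%:R.
  apply: (@card_le_span R T {set T} S Bad U (fun L y => dot (U y) L) c) => //.
  - by case/andP: c_bounds; lra.
  - move=> x; rewrite -[leRHS]mulr1 -(U_diag x) -U_idem le_eqVlt; apply/orP; left.
    by apply/eqP/eq_bigr => y _; rewrite expr2 (U_sym y).
  move=> a ha; pose v x := \sum_y a y * U y x.
  have dotE L' : dot v L' = \sum_y a y * dot (U y) L'.
    by rewrite exchange_big; apply: eq_bigr => y _; rewrite mulr_sumr.
  have dot0 L' : L' \in Ls -> dot v L' = 0.
    move=> LL; have [L'S|L'S] := boolP (L' \in S); first by rewrite dotE ha.
    rewrite dotE big1 // => y _; rewrite clique_tight ?mulr0 //; first exact: Ls_clique.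
    by move: L'S; rewrite inE LL negbK => /eqP.
  have eig x : \sum_(y | e x y) v y = - r * v x.
    rewrite exchange_big mulr_sumr; apply: eq_bigr => y _.
    by rewrite -mulr_sumr U_eigen mulrCA.
  (* The left side vanishes, and by [eig] the right side is the sum of
     [((degL x)%:R - r) * v x ^+ 2], whose terms are nonnegative by [degL_ge]. *)
  have := sum_sqr_lines v; rewrite big1 => [|L' /dot0 ->]; last by rewrite expr0n.
  rewrite -big_split /= => /esym/eqP; rewrite psumr_eq0 => [/allP h x|x _]; last first.
    rewrite eig (_ : _ + _ = ((degL x)%:R - r) * v x ^+ 2); last by ring.
    by rewrite mulr_ge0 ?sqr_ge0 // subr_ge0 degL_ge.
  rewrite inE => xB; have := h x (mem_index_enum _); rewrite eig /=.
  rewrite (_ : _ + _ = ((degL x)%:R - r) * v x ^+ 2); last by ring.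
  by rewrite mulf_eq0 subr_eq0 (negPf xB) sqrf_eq0 => /eqP.
(* By [degL_eq] every vertex of a line in [S] is in [Bad], and it is on at most [M] lines. *)
have hSB : s * (#|S|)%:R <= M%:R * (#|Bad|)%:R.
  apply: (@le_trans _ _ (\sum_(L in S) (#|L|)%:R)).
    rewrite -[X in _ * X%:R]sum1_card natr_sum mulr_sumr; apply: ler_sum => L'.
    by rewrite mulr1 inE => /andP[/size_ge].
  rewrite -natr_sum -natrM ler_nat.
  rewrite (eq_bigr (fun L : {set T} => \sum_(x in L) 1)%N) => [|L' _]; last by rewrite sum1_card.
  rewrite (exchange_big_dep (mem Bad)) /= => [|L' x]; last first.
    rewrite !inE => /andP[LL sL] xL; apply: contraNneq sL => /degL_eq -> //.
  rewrite mulnC -sum_nat_const; apply: leq_sum => x _; apply: leq_trans (degL_le x).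
  rewrite sum1_card; apply: subset_leq_card; apply/subsetP => L'.
  by rewrite unfold_in !inE => /andP[/andP[-> _] ->].
(* The chain [s |S| <= M |Bad| <= 3/2 M |S|] contradicts [sM] unless [S] is empty. *)
have S0 : #|S| = 0%N.
  apply/eqP; apply: contraT; rewrite -lt0n -(ltr_nat R) => Sp.
  have h1 : M%:R * (#|Bad|)%:R <= M%:R * (c * (#|S|)%:R) by rewrite ler_wpM2l ?ler0n.
  have h2 : M%:R * (c * (#|S|)%:R) <= M%:R * (3 / 2 * (#|S|)%:R).
    by rewrite ler_wpM2l ?ler0n // ler_wpM2r ?ler0n //; case/andP: c_bounds.
  have h3 : 3 / 2 * M%:R * (#|S|)%:R < s * (#|S|)%:R by rewrite ltr_pM2r.
  lra.
move=> LL; apply/eqP; apply: contraT => sL.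
have LS : L \in S by rewrite inE LL.
by rewrite (cards0_eq S0) inE in LS.
Qed.

Lemma degL_r x : (degL x)%:R = r.
Proof.
have := valency x; rewrite -sum_line_sizes => E; apply: (mulIf (lt0r_neq0 beta0)).
rewrite -E /degL -sum1_card natr_sum mulr_suml.
rewrite [LHS](eq_bigl (fun L => (L \in Ls) && (x \in L))) => [|L]; last by rewrite inE.
by apply: eq_bigr => L /andP[/line_size-> _]; ring.
Qed.

End LineSystem.

(** For an eigenvector [v] of eigenvalue [t], [sum_sqr_lines] gives [(r + t) |v|^2] as a sum of
    squares, so [t] is at least [- r]; [u] shows that [- r] is attained. *)
Lemma min_eigenvalue_lines (R : rcfType) (T : finType) (e : rel T) (Ls : {set {set T}})
    (r : R) (u : T -> R) x0 :
  symmetric e -> irreflexive e -> (forall L, L \in Ls -> clique e L) ->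
  (forall x y, e x y -> #|[set L in Ls | (x \in L) && (y \in L)]| = 1%N) ->
  (forall x, (degL Ls x)%:R = r) ->
  (forall y, \sum_(z | e y z) u z = - r * u y) -> u x0 != 0 ->
  min_eigenvalue e (- r).
Proof.
move=> es ei hc he ht hu u0; split.
  apply/eigenvalueP; exists (\row_i u (enum_val i)); last first.
    apply: contraNneq u0 => /rowP/(_ (enum_rank x0)); rewrite !mxE enum_rankK => ->.
    by rewrite eqxx.
  apply/rowP => j; rewrite !mxE -hu [RHS]big_mkcond [RHS]sum_enum_val; apply: eq_bigr => i _.
  by rewrite !mxE es; case: ifP; rewrite ?mulr1 ?mulr0.
move=> t /eigenvalueP[w wt w0].
pose v x := w 0 (enum_rank x).
have eig x : \sum_(y | e x y) v y = t * v x.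
  have /rowP/(_ (enum_rank x)) := wt; rewrite !mxE => <-.
  rewrite [LHS]big_mkcond [LHS]sum_enum_val; apply: eq_bigr => i _.
  by rewrite !mxE /v enum_valK enum_rankK es; case: ifP; rewrite ?mulr1 ?mulr0.
have v0 : 0 < \sum_x v x ^+ 2.
  rewrite lt0r sumr_ge0 ?andbT => [|x _]; last exact: sqr_ge0.
  apply: contraNneq w0 => /eqP; rewrite psumr_eq0 => [/allP h|x _]; last exact: sqr_ge0.
  apply/eqP/rowP => i; have := h (enum_val i) (mem_index_enum _).
  by rewrite /= sqrf_eq0 /v enum_valK mxE => /eqP.
have := sum_sqr_lines ei hc he v.
have : 0 <= \sum_(L in Ls) (\sum_(x in L) v x) ^+ 2.
  by apply: sumr_ge0 => L _; apply: sqr_ge0.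
move=> /[swap] ->; rewrite -big_split /=.
rewrite (eq_bigr (fun x => (r + t) * v x ^+ 2)) => [|x _]; last by rewrite ht eig; ring.
rewrite -mulr_sumr pmulr_lge0 //; lra.
Qed.

(** * Parameters *)

Section IntersectionNumbers.
Variables (R : realFieldType) (T : finType) (e : rel T) (D : nat) (bn cn : nat -> nat).
Variables (b : int) (alpha beta : R).
Hypotheses (G : drg e D bn cn) (H : classical_params D bn cn b alpha beta).
Hypotheses (b2 : 2 <= b) (D3 : (3 <= D)%N).
Local Notation d := (gdist e D).
Local Notation q := (qnum R b).
Local Notation r := (q D).

(** Used to write [r] as a natural number, so that the floor bounding the number of lines is a
    division in [nat]. *)
Lemma qnum_nat i : exists n : nat, q i = n%:R.
Proof.
elim: i => [|i [n IH]]; first by exists 0%N; rewrite qnum0.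
exists (`|b|%N * n + 1)%N; rewrite qnumS // IH natrD natrM; congr (_ * _ + _).
by rewrite -{1}(gez0_abs (le_trans _ b2)).
Qed.

Lemma qnum1 : q 1 = 1.
Proof. by rewrite qnumS // qnum0 mulr0 add0r. Qed.

Lemma qnum2 : q 2 = b%:~R + 1.
Proof. by rewrite qnumS // qnum1 mulr1. Qed.

Lemma cn2E : (cn 2)%:R = (b%:~R + 1) * (1 + alpha) :> R.
Proof. by rewrite (cnE H) ?(ltnW D3) // qnum1 qnum2 mulr1. Qed.

(* [alpha * (b + 1)] is an integer, and [c_3 > 0] makes it greater than [- 1]. *)
Lemma alpha_ge0 : 0 <= alpha.
Proof.
have bb2 : 2 <= b%:~R :> R by have := b2; rewrite -(ler_int R).
have c3 : 0 < (cn 3)%:R :> R by rewrite ltr0n (cn_gt0 G).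
rewrite (cnE H) // pmulr_rgt0 ?qnum_gt0 //= qnum2 in c3.
have E := cn2E.
have bE : b%:~R = `|b|%N%:R :> R by rewrite -{1}(gez0_abs (le_trans _ b2)).
have : (`|b|%N < cn 2)%N by rewrite -(ltr_nat R) E -bE; lra.
rewrite -(ler_nat R) E -natr1 -bE => h.
have : 0 <= (b%:~R + 1) * alpha by lra.
by rewrite pmulr_rge0 //; lra.
Qed.

(** With the indicator of distance 1, [nbrs_gdist_sum] yields [k - b_1 - c_1]. *)
Lemma common_nbrs x y : e x y ->
  (#|nbrs e x :&: nbrs e y|)%:R = beta - 1 + alpha * (r - 1).
Proof.
move=> xy; have := nbrs_gdist_sum G H b2 (ltnW (ltnW D3)) (fun j => (j == 1%N)%:R) x y.
have -> : d x y = 1%N by apply/eqP; rewrite (gdist_eq1 G).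
rewrite qnum1 qnum0 /= !mulr0 !add0r !mulr1 addr0 mul1r => E.
transitivity (\sum_(z | e y z) (d x z == 1%N)%:R : R); last by rewrite E; ring.
rewrite -sum1_card natr_sum big_mkcond [RHS]big_mkcond; apply: eq_bigr => z _.
by rewrite !inE (gdist_eq1 G) andbC; case: (e y z); case: (e x z).
Qed.

End IntersectionNumbers.

(** * Inequalities drawn from the lower bound on [beta] *)

Section Numbers.
Variables (R : realFieldType) (p rn lam mu : nat) (alpha beta : R).
Local Notation bb := (p%:R : R).
Local Notation r := (rn%:R : R).
(* The floor of (2b + 4) / (2b + 3) r. *)
Local Notation M := ((2 * p + 4) * rn %/ (2 * p + 3))%N.
Hypotheses (p2 : (2 <= p)%N) (rn0 : (0 < rn)%N) (alpha0 : 0 <= alpha).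
Hypotheses (lamE : lam%:R = beta - 1 + alpha * (r - 1)).
Hypothesis (muE : mu%:R = alpha * bb + bb + alpha).
Hypothesis beta_ge : (2 * bb + 4) / (2 * bb + 3) * r * (bb + 2) * mu%:R <= beta.

Let bb2 : 2 <= bb. Proof. by rewrite ler_nat. Qed.
Let r1 : 1 <= r. Proof. by rewrite ler1n. Qed.
Let M_le : M%:R * (2 * bb + 3) <= (2 * bb + 4) * r.
Proof. by rewrite -!natrM -!natrD -!natrM ler_nat leq_trunc_div. Qed.
Let M_gt : (2 * bb + 4) * r < (M%:R + 1) * (2 * bb + 3).
Proof. by rewrite natr1 -!natrM -!natrD -!natrM ltr_nat ltn_ceil // addn3. Qed.

Lemma beta_le_lamS : beta <= lam.+1%:R.
Proof.
have : 0 <= alpha * (r - 1) by rewrite mulr_ge0 // subr_ge0 r1.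
by rewrite -natr1 lamE; lra.
Qed.

Lemma bound_gt0 : (0 < M)%N.
Proof. by rewrite divn_gt0; clear -p2 rn0; nia. Qed.

(** From [b >= 2] come [mu >= 2 + 3 alpha] and [b + 2 >= 4], and the leading fraction is at least 1;
    hence [4 r (2 + 3 alpha)] as a lower bound. *)
Lemma beta_ge_alpha_r : 12 * (alpha * r) + 8 * r <= beta.
Proof.
apply: le_trans beta_ge; have B2 := bb2; have R1 := r1; have A0 := alpha0.
apply: (@le_trans _ _ (r * (4 * mu%:R))).
  have : 2 + 3 * alpha <= mu%:R by rewrite muE; nra.
  have ar : 0 <= alpha * r by apply: mulr_ge0 => //; lra.
  move=> h; have : r * (2 + 3 * alpha) <= r * mu%:R by apply: ler_wpM2l => //; lra.
  lra.
rewrite -mulrA; apply: ler_pM; [lra | by rewrite mulr_ge0 ?ler0n //; lra | | ].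
  rewrite ler_peMl ?ler_pdivlMr; lra.
by rewrite ler_wpM2r ?ler0n //; lra.
Qed.

Lemma bound_mul_mu : M%:R * (bb + 2) * mu%:R <= beta.
Proof.
apply: le_trans beta_ge; rewrite ler_wpM2r ?ler0n // ler_wpM2r ?addr_ge0 ?ler0n //.
by rewrite mulrAC ler_pdivlMr ?M_le //; have := bb2; lra.
Qed.

Lemma gap_mu_lam : ((2 * M.-1 + 1) * mu < lam.+1)%N.
Proof.
have M0 := bound_gt0; rewrite -(ltr_nat R); apply: lt_le_trans beta_le_lamS.
apply: (@le_lt_trans _ _ (2 * (M%:R * mu%:R))).
  by rewrite -!natrM ler_nat; nia.
have h : M%:R * mu%:R * 4 <= M%:R * mu%:R * (bb + 2).
  by apply: ler_wpM2l; [rewrite mulr_ge0 ?ler0n | have := bb2; lra].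
have := bound_mul_mu; have := beta_ge_alpha_r; have := r1.
have : 0 <= alpha * r by rewrite mulr_ge0 ?ler0n.
rewrite mulrAC; lra.
Qed.

(** As [b + 2 >= 4], [bound_mul_mu] makes [M * mu] at most a quarter of [beta]. *)
Lemma line_size_ge n : (lam.+2 <= n + M.-1 * mu)%N -> 3 / 4 * beta + 1 <= n%:R.
Proof.
move=> hn; have M0 := bound_gt0.
have : (lam.+2 <= n + M * mu)%N by nia.
rewrite -(ler_nat R) natrD natrM -[lam.+2%:R]natr1 => h1.
have h : M%:R * mu%:R * 4 <= M%:R * mu%:R * (bb + 2).
  by apply: ler_wpM2l; [rewrite mulr_ge0 ?ler0n | have := bb2; lra].
have := bound_mul_mu; rewrite mulrAC; have := beta_le_lamS; lra.
Qed.

Lemma bound_lt_line_size : 3 / 2 * M%:R < 3 / 4 * beta + 1.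
Proof.
have h1 := M_le; have B2 := bb2; have R1 := r1; have h3 := beta_ge_alpha_r.
have h4 : 0 <= alpha * r by rewrite mulr_ge0 ?ler0n.
have : M%:R <= 2 * r.
  rewrite -(ler_pM2r (_ : 0 < 2 * bb + 3)); last lra.
  apply: le_trans h1 _; nra.
lra.
Qed.

(** By [bound_mul_mu] the pair term is at most [(M + 1) beta / (2 (b + 2))]. The inequality would
    thus give [(M + 1) (2b + 3) <= (2b + 4) r], which contradicts the choice of [M] as a floor and
    explains the fraction [(2b + 4) / (2b + 3)]. *)
Lemma bonferroni_fails : ~ (M.+1%:R * lam.+1%:R <= r * beta + 'C(M.+1, 2)%:R * mu%:R).
Proof.
move=> h; have B2 := bb2.
have b0 : 0 < beta.
  have := beta_ge_alpha_r; have := r1; have : 0 <= alpha * r by rewrite mulr_ge0 ?ler0n.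
  lra.
have c2 : 'C(M.+1, 2)%:R * 2 = (M%:R + 1) * M%:R :> R.
  by rewrite natr1 -!natrM; congr _%:R; rewrite mulnC -mul_bin_diag bin1.
have h1 : (M%:R + 1) * beta <= r * beta + 'C(M.+1, 2)%:R * mu%:R.
  apply: le_trans h; rewrite natr1; apply: ler_wpM2l; [exact: ler0n | exact: beta_le_lamS].
have h2 : (M%:R + 1) * (M%:R * (bb + 2) * mu%:R) <= (M%:R + 1) * beta.
  by apply: ler_wpM2l bound_mul_mu; rewrite addr_ge0 ?ler0n.
have h3 : (M%:R + 1) * beta * (2 * (bb + 2)) <=
    (r * beta + 'C(M.+1, 2)%:R * mu%:R) * (2 * (bb + 2)) by apply: ler_wpM2r => //; lra.
have h4 : 'C(M.+1, 2)%:R * mu%:R * (2 * (bb + 2)) = (M%:R + 1) * (M%:R * (bb + 2) * mu%:R).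
  transitivity ('C(M.+1, 2)%:R * 2 * mu%:R * (bb + 2)); first by ring.
  by rewrite c2; ring.
have : (M%:R + 1) * (2 * bb + 3) * beta <= (2 * bb + 4) * r * beta by lra.
by rewrite ler_pM2r // leNgt M_gt.
Qed.

End Numbers.



Theorem theorem19 (R : rcfType) (T : finType) (e : rel T) (D : nat)
    (bn cn : nat -> nat) (b : int) (alpha beta : R) :
  drg e D bn cn ->
  @classical_params R D bn cn b alpha beta ->
  (2 <= b)%R -> (3 <= D)%N ->
  let r : R := @qnum R b D in
  let bb : R := b%:~R in
  beta >= Num.max
    ((2 * bb + 4) / (2 * bb + 3) * r * (bb + 2) * (alpha * bb + bb + alpha))
    ((2 * bb + 4) / (2 * bb + 3) * r * ((bb + 1) * (bb ^+ 2 + bb + 2) - 3)) ->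
  @geometric R T e (bn 0%N).
Proof.
move=> G H b2 D3 r bb; rewrite ge_max => /andP[hbeta _].
have D0 : (0 < D)%N by apply: leq_trans D3.
have [[es ei] _ _ _ _] := G.
pose p := `|b|%N.
have bE : b = p by rewrite /p gez0_abs // (le_trans _ b2).
have bbE : bb = p%:R by rewrite /bb bE.
have p2 : (2 <= p)%N by rewrite -lez_nat -bE.
have [rn rE] := qnum_nat R b2 D.
have rn0 : (0 < rn)%N by rewrite -(ltr_nat R) -rE r_gt0.
have alpha0 : 0 <= alpha := alpha_ge0 G H b2 D3.
(* An edge exists because [D] is positive; [lam] is read off it, and [common_nbrs] carries the value
   to all edges. *)
have [x0 [y0 /eqP]] := exists_gdist G D0; rewrite (gdist_eq1 G) => xy0.
pose lam := #|nbrs e x0 :&: nbrs e y0|.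
have lamE : lam%:R = beta - 1 + alpha * (rn%:R - 1).
  by rewrite -rE (common_nbrs G H b2 D3).
pose mu := (cn 2).-1.
have cn2 : cn 2 = mu.+1.
  by rewrite prednK //; apply: (cn_gt0 G); rewrite /= ltnW.
have muE : mu%:R = alpha * p%:R + p%:R + alpha.
  apply: (addIr 1); rewrite natr1 -cn2 (cn2E H b2 D3) -/bb bbE; ring.
have beta_ge : (2 * p%:R + 4) / (2 * p%:R + 3) * rn%:R * (p%:R + 2) * mu%:R <= beta.
  by rewrite muE -rE -bbE.
have beta_rn := beta_ge_alpha_r p2 rn0 alpha0 muE beta_ge.
have M0 := bound_gt0 p2 rn0.
have indepM := bonferroni_fails p2 rn0 alpha0 lamE muE beta_ge.
have gapM := gap_mu_lam p2 rn0 alpha0 lamE muE beta_ge.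
have sizeM := line_size_ge p2 rn0 alpha0 lamE beta_ge.
have sM := bound_lt_line_size p2 rn0 alpha0 muE beta_ge.
set M := (_ %/ _)%N in M0 indepM gapM sizeM sM.
have lam_eq x y : e x y -> #|nbrs e x :&: nbrs e y| = lam.
  by move=> xy; apply/eqP; rewrite -(eqr_nat R) !(common_nbrs G H b2 D3).
have mu_le x y : x != y -> ~~ e x y -> (#|nbrs e x :&: nbrs e y| <= mu.+1)%N.
  by rewrite -cn2; apply: (nonadj_nbrs G).
have valency x : (#|nbrs e x|)%:R = r * beta.
  by rewrite (card_nbrs G) // (bnE H) // qnum0 mulr0 !subr0.
have indep_bound x Y : indep e Y -> Y \subset nbrs e x -> (#|Y| <= M.-1.+1)%N.
  (* A larger independent set would contain one of exactly [M.+1] vertices, the size excluded by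
     [indepM]. *)
  move=> iY sY; rewrite prednK // leqNgt; apply/negP => /subset_of_card[Z sZ cZ].
  apply: indepM; rewrite -rE -(valency x) -cZ -!natrM -natrD ler_nat.
  apply: (card_indep_nbrs es ei lam_eq mu_le) (subset_trans sZ sY).
  by apply/indepP => y z yZ zZ; apply: (indepP _ _ iY); apply: (subsetP sZ).
pose Ls := lines e lam mu M.-1.
have Lc L : L \in Ls -> clique e L by apply: line_clique.
have Le := unique_line es ei lam_eq mu_le indep_bound gapM.
have beta_r : 12 * (alpha * r) + 8 * r <= beta by rewrite /r rE.
have beta0 : 0 < beta := beta_gt0 b2 D0 alpha0 beta_r.
have r0 : 0 < r by rewrite r_gt0.
have degM x : (degL Ls x <= M)%N.
  by have := lines_per_vertex es ei lam_eq mu_le indep_bound gapM x; rewrite prednK.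
have sizeLs L : L \in Ls -> 3 / 4 * beta + 1 <= (#|L|)%:R :> R.
  by rewrite inE => /andP[_ /sizeM].
have U_eig x y := U_eigen G H b2 D0 alpha0 beta_r x y.
(* Each row of [U] is a [- r]-eigenvector by [U_eig], so [U_mul] applies to it. *)
have idem x y : \sum_z U e D b alpha beta x z * U e D b alpha beta z y
    = normU D b alpha beta * U e D b alpha beta x y.
  rewrite (U_sym b alpha beta G x y) -(U_mul G H b2 D0 alpha0 (U_eig y)).
  by apply: eq_bigr => z _; rewrite (U_sym b alpha beta G z y).
have Ud := U_diag b alpha beta G; have Us := U_sym b alpha beta G.
have Ue x y : e x y -> _ := @U_edge R T e D bn cn b alpha beta G x y.
have cb := normU_bounds b2 D0 alpha0 beta_r.
have sizeL := line_size ei Lc Le beta0 valency Ud Us Ue U_eig idem cb degM sizeLs sM.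
have degR := degL_r ei Lc Le beta0 valency Ud Us Ue U_eig idem cb degM sizeLs sM.
exists (- r); split.
  apply: (min_eigenvalue_lines es ei Lc Le degR (U_eig x0) (x0 := x0)).
  by rewrite Ud oner_neq0.
exists Ls; split=> // L LL; split; first exact: Lc.
(* With [k = r * beta], the Delsarte size [1 + k / r] is [beta + 1]. *)
rewrite sizeL // opprK (bnE H) // qnum0 mulr0 !subr0 mulrAC divff ?lt0r_neq0 //; ring.
Qed.
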